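(* Let $G$ be a finite abelian group of order $v$, let $D$ be a subset of $G$ with $|D| = k$ and $1_G \notin D$, and let $\lambda, \mu$ be integers satisfying $k(k-1) = \lambda k + \mu(v-1-k)$ and $(\lambda-\mu)^2 + 4(k-\mu) \ge 0$. Then $D$ is a $(v,k,\lambda,\mu)$ partial difference set in $G$ satisfying $D^{(-1)} = D$ if and only if, for every nonprincipal character $\chi$ of $G$, \[ \chi(D) = \frac{1}{2}\Big( \lambda-\mu \pm \sqrt{(\lambda-\mu)^2 + 4(k-\mu)} \Big) \] for some choice of the sign $\pm$ (which may depend on $\chi$).
   Context: The group $G$ is finite and abelian, written multiplicatively, with identity $1_G$. For a group $G$ of order $v$, a $k$-subset $D$ of $G$ not containing $1_G$ is a $(v,k,\lambda,\mu)$ partial difference set in $G$ if the multiset $\{\{ xy^{-1} \mid x,y \in D,\ x \ne y \}\}$ contains each element of $D$ exactly $\lambda$ times and each nonidentity element of $G \setminus D$ exactly $\mu$ times. For a subset $D \subseteq G$, $D^{(-1)} = \{ g^{-1} \mid g \in D \}$. A character of $G$ is a group homomorphism $\chi$ from $G$ to the multiplicative group $\mathbb{C}^*$ of the complex field. The principal character is the one mapping every element of $G$ to $1$; all other characters are nonprincipal. For a subset $D \subseteq G$, the character sum of $\chi$ on $D$ is $\chi(D) = \sum_{g \in D} \chi(g) \in \mathbb{C}$. *)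

(* Defs.v *)
From mathcomp Require Import all_boot all_order all_fingroup all_algebra.
From mathcomp Require Import reals complex.

Set Implicit Arguments.
Unset Strict Implicit.
Unset Printing Implicit Defensive.

Import GRing.Theory Num.Theory.
Local Open Scope ring_scope.

Section PartialDifferenceSets.
Variables (gT : finGroupType) (G D : {set gT}).

(* The multiset of quotients, as a sequence: the multiplicity of g is
   [count_mem g (quotients D)]. *)
Definition quotients (A : {set gT}) : seq gT :=
  [seq (p.1 * p.2^-1)%g
     | p <- [seq (x, y) | x <- enum A, y <- enum A] & p.1 != p.2].

Definition partial_difference_set (v k : nat) (lambda mu : int) : Prop :=
  [/\ [/\ #|G| = v, D \subset G, #|D| = k & 1%g \notin D],
      {in D, forall g, (count_mem g (quotients D))%:Z = lambda}
    & {in G :\: D, forall g, g != 1%g ->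
        (count_mem g (quotients D))%:Z = mu}].

End PartialDifferenceSets.

Section Characters.
Variables (R : realType) (gT : finGroupType).

(* Homomorphisms from G to the multiplicative group of R[i]; the values of
   chi outside G are irrelevant. *)
Definition is_character (G : {set gT}) (chi : gT -> R[i]) : Prop :=
  {in G, forall x, chi x != 0} /\
  {in G &, forall x y, chi (x * y)%g = chi x * chi y}.

Definition is_principal (G : {set gT}) (chi : gT -> R[i]) : Prop :=
  {in G, forall x, chi x = 1}.

Definition character_sum (chi : gT -> R[i]) (D : {set gT}) : R[i] :=
  \sum_(g in D) chi g.

End Characters.

(* Main.v *)
Require Import Defs.
From mathcomp Require Import all_boot all_order all_fingroup all_algebra.
From mathcomp Require Import cyclic separable cyclotomic mxrepresentation.
From mathcomp Require Import reals complex ring.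

(* Let b = lambda - mu and c = k - mu. A set D = D^(-1) is a partial difference
   set exactly when, in the group ring, D D^(-1) - k = b D + mu (G - 1). Applying
   a nonprincipal character chi gives X^2 = b X + c for X = chi(D), whose roots
   are the two stated values. Conversely, these values are real, so
   chi(D^(-1)) = conj (chi(D)) = chi(D); all characters (the principal one by
   counting) agree on both sides of D^(-1) = D and of the group ring equation,
   and characters separate the elements of C[G]. *)

Set Implicit Arguments.
Unset Strict Implicit.
Unset Printing Implicit Defensive.

Import GRing.Theory Num.Theory.
Local Open Scope ring_scope.
Local Open Scope complex_scope.

(** * Simultaneous diagonalization of representations of abelian groups *)

Lemma repr_diagonalizable (F : numClosedFieldType) (gT : finGroupType)
    (G : {group gT}) (n : nat) (rG : mx_representation F G n) (x : gT) :
  x \in G -> diagonalizable (rG x).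
Proof.
case: n rG => [|n] rG Gx.
  exists 1%:M; first exact: unitmx1.
  by apply/is_diag_mxP=> -[].
apply/diagonalizableP.
(* Since x^|G| = 1, the polynomial X^|G| - 1 annihilates [rG x]; over a closed field of
   characteristic 0 it splits with distinct roots. *)
have [rs Drs] := closed_field_poly_normal ('X^#|G| - 1 : {poly F}).
have monX : 'X^#|G| - 1 \is @monic F by rewrite monic_Xn_sub_1 ?cardG_gt0.
rewrite (monicP monX) scale1r in Drs.
exists rs.
  by rewrite -separable_prod_XsubC -Drs separable_Xn_sub_1 // pnatr_eq0 -lt0n
    cardG_gt0.
rewrite -Drs; apply: mxminpoly_min.
by rewrite rmorphB rmorphXn rmorph1 /= horner_mx_X -repr_mxX // expg_cardG //
  repr_mx1 subrr.
Qed.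

Lemma abelian_repr_codiagonalizable (F : numClosedFieldType)
    (gT : finGroupType) (G : {group gT}) (n : nat)
    (rG : mx_representation F G n) :
  abelian G -> codiagonalizable [seq rG x | x <- enum G].
Proof.
move=> abG; apply/codiagonalizableP; split.
  move=> _ _ /mapP[x + ->] /mapP[y + ->]; rewrite !mem_enum => Gx Gy.
  by rewrite /comm_mx -!repr_mxM // (centsP abG x Gx y Gy).
by move=> _ /mapP[x + ->]; rewrite mem_enum; apply: repr_diagonalizable.
Qed.

(** * Characters of a finite abelian group *)

Section Characters.
Variables (R : realType) (gT : finGroupType) (G : {group gT}).
Implicit Types (chi f : gT -> R[i]) (x y : gT).

(* The regular representation of an abelian group is a simultaneous conjugate
   of a diagonal one, whose diagonal entries are characters. *)
Lemma eq0_character_transform f :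
    abelian G ->
    (forall chi, is_character G chi -> \sum_(x in G) f x * chi x = 0) ->
  {in G, forall x, f x = 0}.
Proof.
move=> abG f0 x Gx.
pose rG := regular_repr R[i] G.
have [P Pu /allP diagP] := abelian_repr_codiagonalizable rG abG.
pose chi (i : 'I_#|G|) y := (P *m rG y *m invmx P) i i.
have PrE y : y \in G -> P *m rG y *m invmx P = diag_mx (\row_i chi i y).
  move=> Gy.
  have /diagP/(similar_diagP _ Pu) Py : rG y \in [seq rG z | z <- enum G].
    by rewrite map_f ?mem_enum.
  apply/matrixP=> i j; rewrite [RHS]mxE.
  by case: eqVneq => [<-|neq_ij]; [rewrite [in RHS]mxE | rewrite Py].
have chiM i : {in G &, forall y z, chi i (y * z)%g = chi i y * chi i z}.
  move=> y z Gy Gz; rewrite {1}/chi repr_mxM //.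
  have -> : P *m (rG y *m rG z) *m invmx P =
            (P *m rG y *m invmx P) *m (P *m rG z *m invmx P).
    by rewrite !mulmxA mulmxKV.
  by rewrite !PrE // mulmx_diag !mxE eqxx mulr1n.
have chi1 i : chi i 1%g = 1 by rewrite /chi repr_mx1 mulmx1 mulmxV // mxE eqxx.
have chiG i : is_character G (chi i).
  split=> // y Gy; apply/eqP=> y0; have := chi1 i.
  rewrite -(mulgV y) chiM ?groupV // y0 mul0r => /eqP.
  by rewrite eq_sym oner_eq0.
(* After conjugation by [P] the sum is diagonal, and its i-th diagonal entry is the transform of [f]
   at the character [chi i], which vanishes by hypothesis. *)
have sum0 : \sum_(y in G) f y *: rG y = 0.
  have: P *m (\sum_(y in G) f y *: rG y) *m invmx P = 0.
    rewrite mulmx_sumr mulmx_suml; apply/matrixP=> i j.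
    rewrite summxE mxE.
    have [<-|neq_ij] := eqVneq i j.
      rewrite -[RHS](f0 (chi i)) //; apply: eq_bigr => y Gy.
      by rewrite -scalemxAr -scalemxAl mxE.
    apply: big1 => y Gy.
    by rewrite -scalemxAr -scalemxAl PrE // !mxE (negPf neq_ij) mulr0.
  move/(congr1 (fun A => invmx P *m A *m P)).
  by rewrite mulmx0 mul0mx !mulmxA mulmxKV // mulVmx // mul1mx.
(* The regular matrices are linearly independent: [gring_proj x] reads off the coefficient of
   [rG x]. *)
have := congr1 (gring_proj x) sum0; rewrite linear0 linear_sum /=.
rewrite (bigD1 x) //= linearZ /= gring_projE // eqxx.
rewrite big1 => [|y /andP[Gy nyx]].
  by rewrite addr0 /= => /eqP; rewrite scaler_eq0 oner_eq0 orbF => /eqP.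
by rewrite linearZ /= gring_projE // eq_sym (negPf nyx) scaler0.
Qed.

Lemma character1 chi : is_character G chi -> chi 1%g = 1.
Proof.
case=> chi0 chiM; apply: (mulfI (chi0 _ (group1 G))).
by rewrite -chiM ?group1 // mulg1 mulr1.
Qed.

Lemma characterV chi x : is_character G chi -> x \in G ->
  chi x^-1%g = (chi x)^-1.
Proof.
move=> chiG Gx; have [chi0 chiM] := chiG.
apply: (mulfI (chi0 _ Gx)).
by rewrite -chiM ?groupV // mulgV character1 // mulfV ?chi0.
Qed.

Lemma characterX chi x n : is_character G chi -> x \in G ->
  chi (x ^+ n)%g = chi x ^+ n.
Proof.
move=> chiG Gx; have [chi0 chiM] := chiG.
elim: n => [|n IHn]; first by rewrite character1.
by rewrite expgS chiM ?groupX // IHn exprS.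
Qed.

(** A value of a character is a |G|-th root of unity, hence has norm 1, so its inverse is its
    conjugate. *)
Lemma characterV_conj chi x : is_character G chi -> x \in G ->
  chi x^-1%g = Num.conj (chi x).
Proof.
move=> chiG Gx; rewrite characterV // invC_norm.
suff -> : `|chi x| = 1 by rewrite expr1n invr1 mul1r.
apply/eqP; rewrite -(@pexpr_eq1 _ _ #|G|) ?cardG_gt0 ?normr_ge0 //.
by rewrite -normrX -characterX // expg_cardG // character1 // normr1.
Qed.

Lemma is_principalP chi :
  reflect (is_principal G chi) [forall x in G, chi x == 1].
Proof. by apply: (iffP forall_inP) => chi1 x /chi1/eqP. Qed.

(** Translating G by an x with [chi x != 1] permutes the terms but multiplies the sum by [chi x]. *)
Lemma sum_character_eq0 chi : is_character G chi -> ~ is_principal G chi ->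
  character_sum chi G = 0.
Proof.
move=> chiG chi_nt; have [chi0 chiM] := chiG.
have [x Gx chix] : exists2 x, x \in G & chi x != 1.
  by apply/exists_inP; rewrite -negb_forall_in; apply/is_principalP.
apply/eqP; have : (chi x - 1) * character_sum chi G == 0.
  rewrite mulrBl mul1r subr_eq0 mulr_sumr; apply/eqP.
  rewrite [RHS](reindex_inj (mulgI x)) /=.
  by apply: eq_big => [y|y Gy]; rewrite ?groupMl ?chiM.
by rewrite mulf_eq0 subr_eq0 (negPf chix).
Qed.

Lemma sum_count_mem (s : seq gT) f :
    {subset s <= G} ->
  \sum_(x in G) (count_mem x s)%:R * f x = \sum_(x <- s) f x.
Proof.
elim: s => [|y s IHs] sG.
  by rewrite big_nil big1 // => x _; rewrite mul0r.
rewrite big_cons -IHs => [|x sx]; last by rewrite sG // inE sx orbT.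
have Gy : y \in G by rewrite sG ?mem_head.
under eq_bigr do rewrite /= natrD mulrDl.
rewrite big_split /=; congr (_ + _).
rewrite (bigD1 y) //= eqxx mul1r big1 ?addr0 // => x /andP[_ nxy].
by rewrite eq_sym (negPf nxy) mul0r.
Qed.

End Characters.

(** * The multiset of quotients and its character transform *)

Section Quotients.
Variables (gT : finGroupType) (G : {group gT}) (D : {set gT}).
Hypothesis sDG : D \subset G.

Lemma quotients_sub : {subset quotients D <= G}.
Proof.
move=> _ /mapP[p + ->]; rewrite mem_filter => /andP[_ /allpairsP[[x y]]] /=.
rewrite !mem_enum => -[Dx Dy ->] /=.
by rewrite groupM ?groupV ?(subsetP sDG).
Qed.

Lemma count_quotients1 : count_mem 1%g (quotients D) = 0.
Proof.
apply/count_memPn/mapP=> -[p]; rewrite mem_filter => /andP[/eqP neq_p _] p1.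
by apply: neq_p; apply/eqP; rewrite eq_mulgV1 -p1.
Qed.

Section Transform.
Variables (R : realType) (chi : gT -> R[i]).
Hypothesis chiG : is_character G chi.

Lemma character_sum_conj :
  character_sum chi [set g^-1%g | g in D] = Num.conj (character_sum chi D).
Proof.
rewrite /character_sum big_imset /= => [|x y _ _]; last exact: invg_inj.
rewrite rmorph_sum; apply: eq_bigr => x Dx.
by rewrite (characterV_conj chiG) ?(subsetP sDG).
Qed.

(** All pairs of elements of D, equal ones included, contribute chi(D) times its conjugate; the |D|
    diagonal pairs, left out of [quotients], contribute chi(1) = 1 each. *)
Lemma sum_count_quotients :
  \sum_(x in G) (count_mem x (quotients D))%:R * chi x =
  character_sum chi D * Num.conj (character_sum chi D) - #|D|%:R.
Proof.
have [_ chiM] := chiG.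
rewrite (sum_count_mem _ quotients_sub) big_map big_filter.
pose F (p : gT * gT) := chi (p.1 * p.2^-1)%g.
set s := [seq _ | x <- _, y <- _].
have sumE (P : rel gT) : \sum_(p <- s | P p.1 p.2) F p =
    \sum_(x in D) \sum_(y in D | P x y) F (x, y).
  rewrite big_mkcond big_allpairs big_enum; apply: eq_bigr => x _.
  by rewrite big_enum [RHS]big_mkcondr.
have diag : \sum_(p <- s | p.1 == p.2) F p = #|D|%:R.
  rewrite (sumE (fun x y => x == y)) -sum1_card natr_sum.
  apply: eq_bigr => x Dx; rewrite (big_pred1 x) => [|y]; last first.
    by rewrite /= [x == y]eq_sym; case: eqP => [->|_]; rewrite ?Dx ?andbF.
  by rewrite /F mulgV (character1 chiG).
have full : \sum_(p <- s) F p =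
    character_sum chi D * Num.conj (character_sum chi D).
  rewrite (sumE (fun _ _ => true)) rmorph_sum mulr_suml.
  apply: eq_bigr => x Dx; rewrite mulr_sumr.
  apply: eq_big => [y|y]; rewrite andbT // => Dy.
  have [Gx Gy] := (subsetP sDG _ Dx, subsetP sDG _ Dy).
  by rewrite /F chiM ?groupV // (characterV_conj chiG).
rewrite -full -diag [in RHS](bigID (fun p => p.1 == p.2)) /=.
by rewrite [RHS]addrC addKr.
Qed.

End Transform.
End Quotients.

(* The coefficient of x in (lambda - mu) D + mu (G - 1), for x in G. *)
Definition pds_coef (gT : finGroupType) (D : {set gT}) (lambda mu : int)
    (x : gT) : int :=
  (lambda - mu) *+ (x \in D) + (mu - mu *+ (x == 1%g)).

(** This turns the definition into one identity of coefficients on all of G, to which characters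
    apply. At x = 1 both sides are 0: pairs of equal elements are excluded, and 1 is not in D. *)
Lemma partial_difference_setE (gT : finGroupType) (G : {group gT})
    (D : {set gT}) (lambda mu : int) :
    D \subset G -> 1%g \notin D ->
  partial_difference_set G D #|G| #|D| lambda mu <->
  {in G, forall x, (count_mem x (quotients D))%:Z = pds_coef D lambda mu x}.
Proof.
move=> sDG D1; rewrite /pds_coef; split=> [[_ cD cGD] x Gx | cG].
  have [->|nx1] := eqVneq x 1%g.
    by rewrite count_quotients1 (negPf D1) mulr0n mulr1n subrr addr0.
  rewrite mulr0n subr0; have [Dx|nDx] := boolP (x \in D).
    by rewrite cD // mulr1n subrK.
  by rewrite cGD ?inE ?nDx // mulr0n add0r.
split=> [|x Dx|x /setDP[Gx nDx] nx1] //.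
  rewrite cG ?(subsetP sDG) // Dx; case: eqP => [x1|_].
    by rewrite x1 (negPf D1) in Dx.
  by rewrite mulr0n subr0 mulr1n subrK.
by rewrite cG // (negPf nDx) (negPf nx1) !mulr0n subr0 add0r.
Qed.

Lemma sum_pds_coef (R : realType) (gT : finGroupType) (G : {group gT})
    (D : {set gT}) (lambda mu : int) (chi : gT -> R[i]) :
    D \subset G -> is_character G chi ->
  \sum_(x in G) (pds_coef D lambda mu x)%:~R * chi x =
  (lambda - mu)%:~R * character_sum chi D + mu%:~R * (character_sum chi G - 1).
Proof.
move=> sDG chiG; rewrite /pds_coef.
under eq_bigr do rewrite intrD mulrDl.
rewrite big_split /=; congr (_ + _).
  rewrite mulr_sumr [RHS]big_mkcond [LHS]big_mkcond /=; apply: eq_bigr => x _.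
  case: (boolP (x \in D)) => [/(subsetP sDG) ->|_]; first by rewrite mulr1n.
  by rewrite mul0r if_same.
rewrite mulrBr mulr_sumr mulr1.
under eq_bigr do rewrite intrB mulrBl.
rewrite sumrB; congr (_ - _).
rewrite (bigD1 1%g) //= eqxx mulr1n (character1 chiG) mulr1.
by rewrite big1 ?addr0 // => x /andP[_ /negPf->]; rewrite mul0r.
Qed.

(** Here [s] is any square root of the discriminant, so the embedded real square root can be used
    for it. *)
Lemma monic_quadratic_roots (F : numFieldType) (b c s x : F) :
    s ^+ 2 = b ^+ 2 + 4 * c ->
  x ^+ 2 = b * x + c <-> x = 2^-1 * (b + s) \/ x = 2^-1 * (b - s).
Proof.
move=> s2.
have factor : (x - 2^-1 * (b + s)) * (x - 2^-1 * (b - s)) =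
    x ^+ 2 - (b * x + c).
  transitivity (x ^+ 2 - b * x + (b ^+ 2 - s ^+ 2) / 4); first by field.
  by rewrite s2; field.
split=> [x2|xE].
  have /eqP := factor; rewrite x2 subrr mulf_eq0 !subr_eq0.
  by case/orP=> /eqP; [left | right].
apply/eqP; rewrite -subr_eq0 -factor.
by case: xE => ->; rewrite subrr ?mul0r ?mulr0.
Qed.

Theorem theorem2p17 (R : realType) (gT : finGroupType) (G : {group gT})
    (D : {set gT}) (v k : nat) (lambda mu : int)
    (abG : abelian G) (oG : #|G| = v)
    (sDG : D \subset G) (oD : #|D| = k) (D1 : 1%g \notin D)
    (hk : k%:Z * (k%:Z - 1) = lambda * k%:Z + mu * (v%:Z - 1 - k%:Z))
    (hdelta : 0 <= (lambda - mu) ^+ 2 + 4 * (k%:Z - mu)) :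
  partial_difference_set G D v k lambda mu /\ [set g^-1%g | g in D] = D
  <->
  forall chi : gT -> R[i], is_character G chi -> ~ is_principal G chi ->
    let s : R := Num.sqrt ((lambda - mu) ^+ 2 + 4 * (k%:Z - mu))%:~R in
    character_sum chi D = 2^-1 * ((lambda - mu)%:~R + s%:C) \/
    character_sum chi D = 2^-1 * ((lambda - mu)%:~R - s%:C).
Proof.
set s : R := Num.sqrt _.
(* The sign condition [hdelta] is needed because [Num.sqrt] is 0 on negative numbers. *)
have s2 : (s%:C) ^+ 2 = (lambda - mu)%:~R ^+ 2 + 4 * (k%:Z - mu)%:~R :> R[i].
  rewrite -rmorphXn /= sqr_sqrtr ?ler0z // rmorph_int.
  by rewrite [LHS]intrD intrM rmorphXn.
have rootsP := monic_quadratic_roots _ s2.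
rewrite -{1}oG -{1}oD partial_difference_setE //.
split=> [[cD DV] chi chiG chi_nt | chiD].
  apply/rootsP.
  have := sum_count_quotients sDG chiG.
  (* As D is closed under inversion, chi(D) is real, so the transform of the quotients becomes
     chi(D)^2 - k. *)
  have -> : Num.conj (character_sum chi D) = character_sum chi D.
    by rewrite -(character_sum_conj sDG) // DV.
  rewrite (eq_bigr (fun x => (pds_coef D lambda mu x)%:~R * chi x)); last first.
    by move=> x Gx; rewrite -cD // pmulrn.
  rewrite sum_pds_coef // sum_character_eq0 // oD => e.
  rewrite -[LHS](subrK (k%:R)) -e intrB; ring.
have realD (chi : gT -> R[i]) : is_character G chi ->
    Num.conj (character_sum chi D) = character_sum chi D.
  move=> chiG.
  have [chi1|chi_nt] := is_principalP G chi.
    rewrite rmorph_sum; apply: eq_bigr => x Dx.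
    by rewrite chi1 ?rmorph1 ?(subsetP sDG).
  have sR : Num.conj s%:C = s%:C by exact: conjc_real.
  case: (chiD chi chiG chi_nt) => ->.
    by rewrite rmorphM rmorphD /= fmorphV rmorph_nat rmorph_int sR.
  by rewrite rmorphM rmorphB /= fmorphV rmorph_nat rmorph_int sR.
split.
  (* The integer identity is moved into the complex field, where the difference of the two
     coefficient functions is shown to have zero transform. *)
  move=> x Gx; apply/eqP; rewrite -subr_eq0 -(@intr_eq0 R[i]); apply/eqP.
  move: x Gx; apply: eq0_character_transform => // chi chiG.
  under eq_bigr do rewrite intrB mulrBl.
  rewrite sumrB sum_pds_coef //.
  have := sum_count_quotients sDG chiG; rewrite realD // => ->.
  have [chi1|chi_nt] := is_principalP G chi.
    have sum1 (A : {set gT}) : A \subset G -> character_sum chi A = #|A|%:R.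
      move=> sAG; rewrite -sum1_card natr_sum; apply: eq_bigr => x Ax.
      by rewrite chi1 ?(subsetP sAG).
    (* At the principal character the claim is k^2 - k = (lambda - mu) k + mu (v - 1), a
       rearrangement of [hk]. *)
    rewrite !sum1 // oD oG.
    have /(congr1 (fun z : int => z%:~R : R[i])) := hk.
    rewrite !(intrM, intrB, intrD, mulrNz) /= -!pmulrn => e.
    by move/eqP: e; rewrite -subr_eq0 => /eqP e; rewrite -[RHS]e; ring.
  (* Here chi(G) = 0, so the claim is the quadratic equation with constant term k - mu. *)
  rewrite sum_character_eq0 //; have /rootsP := chiD chi chiG chi_nt.
  rewrite oD expr2 => ->; rewrite !intrB; ring.
have sVG : [set g^-1%g | g in D] \subset G.
  by apply/subsetP=> _ /imsetP[x Dx ->]; rewrite groupV (subsetP sDG).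
(* Equality of the two sets is tested on their indicator functions over G; both sets lie in G. *)
suff memV : {in G, forall x,
    (x \in [set g^-1%g | g in D])%:R - (x \in D)%:R = 0 :> R[i]}.
  apply/setP=> x; have [Gx|nGx] := boolP (x \in G).
    have /eqP := memV x Gx; rewrite subr_eq0 eqr_nat.
    by do 2![case: (_ \in _)].
  by rewrite !(contraNF (subsetP _ x) nGx).
apply: eq0_character_transform => // chi chiG.
under eq_bigr do rewrite mulrBl.
have sumI (A : {set gT}) : A \subset G ->
    \sum_(x in G) (x \in A)%:R * chi x = character_sum chi A.
  move=> sAG; rewrite [RHS]big_mkcond [LHS]big_mkcond; apply: eq_bigr => x _.
  case: (boolP (x \in A)) => [/(subsetP sAG) ->|_]; first by rewrite mul1r.
  by rewrite mul0r if_same.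
by rewrite sumrB !sumI // (character_sum_conj sDG) // realD // subrr.
Qed.
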